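(* Let $p'$ be a prime, $q=p'^s$, and let $C$ be a non-elementary $[n,n-d_C+1,d_C]$ MDS cyclic code over $\mathbb{F}_q$ with $n>5$, $n>d_C>2$, and $\gcd(n-2,d_C-2)=1$. If the group $Per(C)$ is doubly transitive, then either 1. $Per(C)=AGL(1,p)$ with $n=p$ a prime, or 2. $Per(C)=PSL(d,p')$ with $n=\frac{p'^{d}-1}{p'-1}$, $d\ge 3$, and $\gcd(p'-1,d)=1$.
   Context: For a linear code $C\subseteq\mathbb{F}_q^n$ and $\sigma\in S_n$, put $\sigma(C)=\{(x_{\sigma^{-1}(1)},\ldots,x_{\sigma^{-1}(n)}) : (x_1,\ldots,x_n)\in C\}$. The permutation group of $C$ is $Per(C)=\{\sigma\in S_n : \sigma(C)=C\}$. The code $C$ is cyclic if $T\in Per(C)$, where $T$ is the shift (a complete cycle of length $n$). The elementary codes are the zero code, the entire space, the repetition code and its dual. Here $d_C$ is the minimum distance of $C$; an $[n,k,d_C]$ code is MDS if $k=n-d_C+1$. $AGL(1,p)$ is the group of affine maps $x\mapsto ax+b$ ($a\neq 0$) of $\mathbb{Z}/p\mathbb{Z}$. $PSL(d,p')$ acts naturally on the points of $\mathbb{P}^{d-1}(\mathbb{F}_{p'})$. Equalities of groups are as permutation groups, up to identification of the coordinate set with the set acted on. *)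

(* Defs.v *)
From mathcomp Require Import all_boot all_order all_algebra all_fingroup all_solvable.

Set Implicit Arguments.
Unset Strict Implicit.
Unset Printing Implicit Defensive.

Import GRing.Theory.
Local Open Scope ring_scope.

Section Codes.

Variables (F : finFieldType) (n : nat).
Implicit Types (x y : 'rV[F]_n) (C : {vspace 'rV[F]_n}).

Definition hamming_dist x y : nat := #|[set i | x 0 i != y 0 i]|.

(* The default value n is only attained vacuously, by the zero code: the
   distance between two words never exceeds n. *)
Definition min_dist C : nat :=
  \big[minn/n]_(u : 'rV[F]_n * 'rV[F]_n | [&& u.1 \in C, u.2 \in C & u.1 != u.2])
    hamming_dist u.1 u.2.

(* The truncated subtraction is harmless because min_dist C <= n. *)
Definition MDS C : bool := \dim C == (n - min_dist C + 1)%N.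

Definition dual_code C : {vspace 'rV[F]_n} :=
  (\bigcap_(c : 'rV[F]_n | c \in C) lker (linfun (mulmxr c^T)))%VS.

Definition repetition_code : {vspace 'rV[F]_n} := <[const_mx 1]>%VS.

Definition elementary C : bool :=
  [|| C == 0%VS, C == fullv, C == repetition_code
    | C == dual_code repetition_code].

(* The word with i-th coordinate x_{s^-1(i)} is col_perm s^-1 x. *)
Definition perm_code (s : 'S_n) C : {vspace 'rV[F]_n} :=
  (linfun (col_perm s^-1%g) @: C)%VS.

Definition Per C : {set 'S_n} := [set s | perm_code s C == C].

Definition shift : 'S_n := perm (@ordS_inj n).

Definition cyclic_code C : bool := shift \in Per C.

End Codes.

(* G and H are the same permutation group once the two sets acted on are
   identified along the bijection f. *)
Definition perm_equiv (S T : finType) (G : {set {perm S}}) (H : {set {perm T}}) :=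
  exists2 f : S -> T, bijective f &
    forall (s : {perm S}) (t : {perm T}),
      (forall x, f (s x) = t (f x)) -> (s \in G) = (t \in H).

(* Meant for p prime, when 'F_p is Z/pZ. *)
Definition AGL1 (p : nat) : {set {perm 'F_p}} :=
  [set s : {perm 'F_p} | [exists a : 'F_p, exists b : 'F_p,
     (a != 0) && [forall x, s x == a * x + b]]].

(* A point of P^{d-1}(F_p) is a line of F_p^d, as the set of its vectors. *)
Definition lines (p d : nat) : {set {set 'rV['F_p]_d}} :=
  [set [set a *: v | a : 'F_p] | v : 'rV['F_p]_d & v != 0].

Definition proj_point (p d : nat) := {L : {set 'rV['F_p]_d} | L \in lines p d}.

(* As a permutation group on points: the image of SL(d, p) in the symmetric
   group of the projective space, the kernel being the scalar matrices. *)
Definition PSL (d p : nat) : {set {perm (proj_point p d)}} :=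
  [set s : {perm (proj_point p d)} | [exists A : 'M['F_p]_d,
     (\det A == 1) && [forall L, val (s L) == [set v *m A | v in val L]]]].

(* Main.v *)
(* Let k = dim C and let g in Per(C) have prime order l and f fixed points.
   A g-fixed word of C vanishing on more than (k-1)/l orbits of length l has at
   least k zeros, so dim C^g <= floor((k-1)/l) + 1.  In the same way F^n/C is
   spanned by the coordinates of any n-k positions, so its coinvariants under g
   have dimension at most floor((n-k-1)/l) + 1.  By rank-nullity the number
   f + (n-f)/l of g-orbits is at most the sum of these two bounds; hence f >= 2
   forces f = 2 with l dividing both n-2 and k-1, that is l | gcd(n-2, d_C-2).
   So only the identity of Per(C) fixes two points.
   If g in Per(C) is not a power of the shift, it agrees with each of them in at
   most one point, so i |-> g(i) - i is injective and vanishes somewhere: the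
   fixed-point-free elements are translations.  In particular conjugates of the shift are translations, and
   Per(C) consists of maps x |-> ax + b of Z/n.  As Per(C) is doubly transitive,
   every nonzero residue is a unit, so n is prime and Per(C) = AGL(1, n): the
   second alternative of the theorem never occurs. *)
Require Import Defs.
From mathcomp Require Import all_boot all_order all_algebra all_fingroup all_solvable.
From mathcomp Require Import zify.

Set Implicit Arguments.
Unset Strict Implicit.
Unset Printing Implicit Defensive.

Import GRing.Theory.
Local Open Scope ring_scope.

Lemma exists_subset_card (T : finType) (A : {set T}) (r : nat) :
  (r <= #|A|)%N -> exists2 B : {set T}, B \subset A & #|B| = r.
Proof.
move=> le_rA; exists [set x in take r (enum A)].
  by apply/subsetP => x; rewrite inE => /mem_take; rewrite mem_enum.
have /card_uniqP: uniq (take r (enum A)) by rewrite take_uniq ?enum_uniq.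
by rewrite size_takel -?cardE // cardsE.
Qed.

(** * Orbits of a permutation of prime order *)

Section PermOrbits.
Local Open Scope nat_scope.
Variables (T : finType) (g : {perm T}) (l : nat).
Hypotheses (l_pr : prime l) (og : #[g]%g = l).

Let moved : {set T} := [set x | g x != x].

Lemma card_porbit_moved x : g x != x -> #|porbit g x| = l.
Proof.
move=> gx; have: #|porbit g x| %| l.
  by rewrite porbitE -og orderE; apply: dvdn_orbit.
case/primeP: l_pr => _ /[apply] /orP[/cards1P[y oy]|/eqP//].
have := porbit_id g x; have := mem_porbit g 1 x; rewrite oy !inE expg1 => /eqP e1 /eqP e2.
by rewrite e1 -e2 eqxx in gx.
Qed.

(** Greedy choice: while the orbits chosen cover fewer than [#|moved|] points, some moved point lies
    outside them and contributes a disjoint orbit. The hypothesis says [(r - 1) * l < #|moved|]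
    without truncated subtraction. *)
Lemma exists_prime_orbits r : r * l < #|moved| + l ->
  exists2 R : {set T}, #|R| <= r & #|\bigcup_(x in R) porbit g x| = r * l.
Proof.
elim: r => [|r IHr] lt_r.
  by exists set0; rewrite ?cards0 // big_set0 cards0.
have {}lt_r : r * l < #|moved| by rewrite mulSn addnC ltn_add2r in lt_r.
have [R leR cR] := IHr (ltn_addr _ lt_r).
have /subsetPn[x mx nx]: ~~ (moved \subset \bigcup_(x in R) porbit g x).
  by apply/negP => /subset_leq_card; rewrite cR leqNgt lt_r.
have cx : #|porbit g x| = l by apply: card_porbit_moved; rewrite inE in mx.
have dis : [disjoint porbit g x & \bigcup_(x in R) porbit g x].
  apply/bigcup_disjointP => y Ry; apply/pred0P => z; apply/negP => /andP[/= zx zy]; case/negP: nx.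
  apply/bigcupP; exists y => //; move: zx zy.
  by rewrite -!eq_porbit_mem => /eqP <- /eqP <-.
have nRx : x \notin R.
  by apply: contra nx => Rx; apply/bigcupP; exists x => //; apply: porbit_id.
exists (x |: R); first by rewrite cardsU1 nRx.
by rewrite bigcup_setU big_set1 cardsU disjoint_setI0 // cards0 subn0 cx cR mulSn.
Qed.

(** Fixed points are orbits of size 1 and all others have size [l], so with [f] fixed points
    [#|T| = f + (#|porbits g| - f) * l]. *)
Lemma card_porbits_ge : #|T| + l.-1 * #|[set x | g x == x]| <= l * #|porbits g|.
Proof.
set f := #|_|; pose Q := porbit g @: [set x | g x == x].
have fix1 x : g x = x -> porbit g x = [set x].
  move=> gx; apply/setP => y; rewrite inE; apply/porbitP/eqP => [[i ->]|->].
    by elim: i => [|i IHi]; rewrite ?perm1 // expgSr permM IHi.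
  by exists 0; rewrite perm1.
have cQ : #|Q| = f.
  rewrite card_in_imset // => x y; rewrite !inE => /eqP gx /eqP gy.
  by rewrite !fix1 // => /set1_inj.
have sQ : Q \subset porbits g.
  by apply/subsetP => O /imsetP[x _ ->]; apply: imset_f.
have partT : \sum_(O in porbits g) #|O| = #|T|.
  rewrite -cardsT; symmetry; apply: card_partition.
  apply/and3P; split.
  - apply/eqP/setP => x; rewrite inE; apply/bigcupP; exists (porbit g x).
      exact: imset_f.
    exact: porbit_id.
  - apply/trivIsetP => _ _ /imsetP[x _ ->] /imsetP[y _ ->] ne.
    apply/pred0P => z; apply: contraNF ne => /andP[/= zx zy]; move: zx zy.
    by rewrite -!eq_porbit_mem => /eqP <- /eqP <-.
  - by apply/imsetP => -[x _ e]; have := porbit_id g x; rewrite -e inE.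
rewrite -partT (bigID (mem Q)) /=.
have -> : \sum_(O in porbits g | O \in Q) #|O| = f.
  rewrite -cQ -sum1_card; apply: eq_big => [O|O /andP[_ /imsetP[x]]].
    by apply: andb_idl => /(subsetP sQ).
  by rewrite inE => /eqP /fix1 gx ->; rewrite gx cards1.
have -> : \sum_(O in porbits g | O \notin Q) #|O| = (#|porbits g| - f) * l.
  have <- : #|porbits g :\: Q| = #|porbits g| - f by rewrite cardsD (setIidPr sQ) cQ.
  rewrite -sum_nat_const; apply: eq_big => [O|O]; first by rewrite inE andbC.
  case/andP=> /imsetP[x _ ->] nQ; apply: card_porbit_moved.
  by apply: contra nQ => gx; apply/imsetP; exists x; rewrite ?inE.
have := subset_leq_card sQ; rewrite cQ => /subnK <-; rewrite addnK.
by case: (l) (prime_gt0 l_pr) => // l' _ /=; rewrite mulSn mulnDr; lia.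
Qed.

End PermOrbits.

(** * Words that vanish on a given set of positions *)

Section Vanishing.
Variables (F : fieldType) (n : nat).
Implicit Types (A B : {set 'I_n}) (U : {vspace 'rV[F]_n}).

Definition vanish A : {vspace 'rV[F]_n} :=
  lker (linfun (colsub (@enum_val _ (mem A)))).

Lemma mem_vanish A (x : 'rV[F]_n) : reflect {in A, forall i, x 0 i = 0} (x \in vanish A).
Proof.
rewrite memv_ker lfunE /=; apply: (iffP eqP) => [x0 i Ai|x0].
  by have := congr1 (fun y : 'rV_ _ => y 0 (enum_rank_in Ai i)) x0; rewrite !mxE enum_rankK_in.
by apply/rowP => j; rewrite !mxE x0 //; apply: enum_valP.
Qed.

Lemma dim_cap_vanish U A : (\dim U <= #|A| + \dim (U :&: vanish A))%N.
Proof.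
rewrite -(limg_ker_dim (linfun (colsub (@enum_val _ (mem A)))) U) addnC leq_add2r.
by apply: leq_trans (dimvS (subvf _)) _; rewrite dimvf dim_matrix mul1r.
Qed.

Lemma dim_vanish A : (n <= #|A| + \dim (vanish A))%N.
Proof.
by have := dim_cap_vanish fullv A; rewrite dimvf dim_matrix mul1r capfv.
Qed.

End Vanishing.

(** * Zeros and interpolation in MDS codes *)

Section MDSCodes.
Variables (F : finFieldType) (n : nat) (C : {vspace 'rV[F]_n}).
Hypothesis mdsC : MDS C.
Local Notation k := (\dim C).

Lemma dim_code_le : (k <= n)%N.
Proof. by have := dimvS (subvf C); rewrite dimvf dim_matrix mul1r. Qed.

(** A nonzero word has weight at least [min_dist C], hence at most [n - min_dist C = k - 1]
    zeros. *)
Lemma mds_word_eq0 (A : {set 'I_n}) (x : 'rV[F]_n) :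
  (k <= #|A|)%N -> x \in C -> {in A, forall i, x 0 i = 0} -> x = 0.
Proof.
move=> leA Cx x0; apply/eqP/negP => /negP nzx.
have: (min_dist C <= hamming_dist x 0)%N.
  apply: (@Order.TotalTheory.bigmin_le_cond _ nat _ _ (x, 0)).
  by rewrite Cx mem0v.
have: (hamming_dist x 0 <= #|~: A|)%N.
  apply/subset_leq_card/subsetP => i; rewrite !inE mxE.
  by apply: contra => /x0 ->.
have := eqP mdsC; have := dim_code_le; have := cardsC A; rewrite card_ord.
lia.
Qed.

(** Completing [A] to [k] positions by [R] bounds the dimension of [C :&: vanish F A] by [k - #|A|];
    the dimension formula then makes the sum fill the space. *)
Lemma mds_addv_vanish (A : {set 'I_n}) : (#|A| <= k)%N -> (C + vanish F A = fullv)%VS.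
Proof.
move=> leA; apply/eqP; rewrite eqEdim subvf dimvf dim_matrix mul1r /=.
have [|R sR cR] := @exists_subset_card _ (~: A) (k - #|A|).
  by have := cardsC A; rewrite card_ord; have := dim_code_le; lia.
have := dim_cap_vanish (C :&: vanish F A) R.
have -> : (C :&: vanish F A :&: vanish F R = 0)%VS.
  apply/eqP; rewrite -subv0; apply/subvP => x.
  rewrite !memv_cap memv0 => /andP[/andP[Cx /mem_vanish xA] /mem_vanish xR].
  apply/eqP/(@mds_word_eq0 (A :|: R)) => // [|i]; last by case/setUP => [/xA|/xR].
  rewrite cardsU disjoint_setI0 ?cards0; last by rewrite disjoint_sym disjoints_subset.
  by rewrite cR; lia.
have := dim_vanish F A; have := dimv_sum_cap C (vanish F A).
rewrite dimv0 cR; move: (\dim (C + _)) (\dim (_ :&: _)) (\dim (vanish F A)) => a b c; lia.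
Qed.

Lemma mds_interpolation (A : {set 'I_n}) (y : 'rV[F]_n) : (#|A| <= k)%N ->
  exists2 x, x \in C & {in A, forall i, x 0 i = y 0 i}.
Proof.
move=> /mds_addv_vanish CA; have: y \in (C + vanish F A)%VS by rewrite CA memvf.
case/memv_addP => x Cx [z /mem_vanish zA ->]; exists x => // i /zA zi.
by rewrite mxE zi addr0.
Qed.

(** * Fixed words and coinvariants of a code automorphism *)

Section Automorphism.
Variable g : 'S_n.
Hypothesis gC : forall x, x \in C -> col_perm g x \in C.

(** [lker N] is the space of [g]-fixed words; the quotient by [limg N] is the space of
    coinvariants. *)
Let N : 'End('rV[F]_n) := (linfun (col_perm g) - \1)%VF.
Let N_E x : N x = col_perm g x - x.
Proof. by rewrite add_lfunE opp_lfunE lfunE id_lfunE. Qed.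

Let N_C x : x \in C -> N x \in C.
Proof. by move=> Cx; rewrite N_E memvB ?gC. Qed.

Let fixed_porbit (x : 'rV[F]_n) i j :
  x \in lker N -> j \in porbit g i -> x 0 j = x 0 i.
Proof.
rewrite memv_ker N_E subr_eq0 => /eqP gx /porbitP[m ->].
elim: m => [|m IHm]; first by rewrite perm1.
by rewrite expgSr permM -IHm -[in RHS]gx mxE.
Qed.

(** Words constant on orbits are fixed; [E] embeds the functions on the set of orbits as such
    words. *)
Lemma card_porbits_le_dim_fixed : (#|porbits g| <= \dim (lker N))%N.
Proof.
have mem_porbits i : porbit g i \in porbits g by apply: imset_f.
pose h i := enum_rank_in (mem_porbits i) (porbit g i).
have h_val i : enum_val (h i) = porbit g i by rewrite enum_rankK_in.
pose E : 'Hom('rV[F]_#|porbits g|, 'rV[F]_n) := linfun (colsub h).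
have injE : lker E == 0%VS.
  apply/lker0P => y z; rewrite !lfunE /= => yz; apply/rowP => j.
  have /imsetP[i _ ij] := enum_valP j.
  have -> : j = h i by apply: enum_val_inj; rewrite h_val.
  by have := congr1 (fun w : 'rV_n => w 0 i) yz; rewrite !mxE.
have <- : \dim (limg E) = #|porbits g|.
  by rewrite limg_dim_eq ?dimvf ?dim_matrix ?mul1r // (eqP injE) capv0.
apply/dimvS/subvP => _ /memv_imgP[y _ ->].
rewrite memv_ker N_E subr_eq0 lfunE /=; apply/eqP/rowP => i; rewrite !mxE.
congr (y 0 _); apply: enum_val_inj; rewrite !h_val.
exact: (porbit_perm g 1 i).
Qed.

Lemma dim_fixed_le (R : {set 'I_n}) :
  (k <= #|\bigcup_(i in R) porbit g i|)%N -> (\dim (C :&: lker N) <= #|R|)%N.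
Proof.
move=> leR; have := dim_cap_vanish (C :&: lker N) R.
suff -> : (C :&: lker N :&: vanish F R = 0)%VS by rewrite dimv0 addn0.
apply/eqP; rewrite -subv0; apply/subvP => x.
rewrite !memv_cap memv0 => /andP[/andP[Cx fx] /mem_vanish xR].
apply/eqP/(mds_word_eq0 leR Cx) => j /bigcupP[i Ri].
by move/(fixed_porbit fx) ->; apply: xR.
Qed.

(** Modulo [limg N] the unit vectors along an orbit coincide, so those at [R] span everything
    supported on [O]; [C] takes care of the at most [k] positions outside [O]. *)
Lemma dim_coinvariants_le (R : {set 'I_n}) :
  (n - k <= #|\bigcup_(i in R) porbit g i|)%N ->
  (n <= \dim (C + limg N) + #|R|)%N.
Proof.
set O := \bigcup_(i in R) _ => leO.
pose S := <<[seq delta_mx 0%R i : 'rV[F]_n | i <- enum R]>>%VS.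
have subO : (vanish F (~: O) <= limg N + S)%VS.
  apply/subvP => x /mem_vanish x0; rewrite (row_sum_delta x).
  apply: memv_suml => i _; have [Oi|nOi] := boolP (i \in O); last first.
    by rewrite x0 ?inE // scale0r mem0v.
  apply: memvZ; have /bigcupP[j Rj /porbitP[m ->]] := Oi.
  elim: m => [|m IHm].
    rewrite perm1; apply: (subvP (addvSr _ _)); apply: memv_span.
    by apply: map_f; rewrite mem_enum.
  rewrite expgSr permM; set i' := (g ^+ m)%g j in IHm *.
  (* [col_perm g] sends the unit vector at [g i'] back to the one at [i']. *)
  have -> : delta_mx 0 (g i') = delta_mx 0 i' - N (delta_mx 0 (g i')).
    rewrite N_E; apply/rowP => t; rewrite !mxE (inj_eq perm_inj).
    by rewrite opprB addrC subrK.
  by rewrite memvB // (subvP (addvSl _ _)) // memv_img ?memvf.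
have full : (C + limg N + S = fullv)%VS.
  apply/eqP; rewrite eqEsubv subvf /=; have leO' : (#|~: O| <= k)%N.
    by have := cardsC O; rewrite card_ord; have := dim_code_le; lia.
  by rewrite -{1}(mds_addv_vanish leO') -addvA addvS.
have: (\dim S <= #|R|)%N by apply: leq_trans (dim_span _) _; rewrite size_map -cardE.
have := dimv_sum_cap (C + limg N) S; rewrite full dimvf dim_matrix mul1r.
by move: (\dim S) (\dim (_ + _)) (\dim (_ :&: _)) => a b c; lia.
Qed.

(** * Fixed points of a nontrivial automorphism *)

Section NontrivialAutomorphism.
Hypotheses (k_gt1 : (1 < k)%N) (k_lt : (k + 2 <= n)%N) (g_neq1 : g != 1%g).

Let moved := [set i | g i != i].

(** Ensures that there are enough orbits of length [l] to apply both dimension bounds. *)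
Lemma mds_aut_moves : (k <= #|moved|)%N && (n - k <= #|moved|)%N.
Proof.
have [i gi] : exists i, g i != i.
  apply/existsP; apply: contraR g_neq1; rewrite negb_exists => /forallP fixg.
  by apply/eqP/permP => i; apply/eqP; rewrite perm1 -[_ == _]negbK.
apply/andP; split; rewrite leqNgt; apply/negP => ltM.
  (* On moved points [x] is the unit word at [i], so [N x] is supported on [i] and its preimage.
     Having at least [n - 2 >= k] zeros it must vanish, yet its entry at [i] is -1. *)
  have [x Cx xi] := mds_interpolation (delta_mx 0 i) (ltnW ltM).
  have x0 j : g j != j -> x 0 j = (j == i)%:R by move=> gj; rewrite xi ?inE // mxE.
  suff /rowP/(_ i) : N x = 0.
    rewrite N_E !mxE !x0 ?(inj_eq perm_inj) // (negPf gi) eqxx sub0r => /eqP.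
    by rewrite oppr_eq0 oner_eq0.
  apply: (@mds_word_eq0 (~: [set i; (g^-1)%g i])) ; last 1 first.
  - move=> j; rewrite !inE negb_or N_E !mxE => /andP[ji jgi].
    have [gj|gj] := eqVneq (g j) j; first by rewrite gj subrr.
    rewrite !x0 ?(inj_eq perm_inj) // (negPf ji) subr0.
    by rewrite (canF_eq (permK g)) (negPf jgi).
  - have := cardsC [set i; (g^-1)%g i]; rewrite cards2 card_ord.
    by case: (i != _) => /=; lia.
  - exact: N_C.
(* As [k > 1], the values 1 at [i] and 0 at [g i] can be prescribed; [N x] vanishes at the fixed
   points, of which there are now more than [k]. *)
have [|x Cx xi] := mds_interpolation (delta_mx 0 i) (A := [set i; g i]).
  by rewrite cards2; apply: leq_trans k_gt1; case: (_ != _).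
suff /rowP/(_ i) : N x = 0.
  rewrite N_E !mxE !xi ?inE ?eqxx ?orbT // !mxE (negPf gi) !eqxx sub0r => /eqP.
  by rewrite oppr_eq0 oner_eq0.
apply: (@mds_word_eq0 (~: moved)); last 1 first.
- by move=> j; rewrite !inE negbK N_E !mxE => /eqP ->; rewrite subrr.
- by have := cardsC moved; rewrite card_ord; lia.
- exact: N_C.
Qed.

Lemma prime_aut_fix_le1 l : prime l -> #[g]%g = l -> coprime (n - 2) (n - k).-1 ->
  (#|[set i | g i == i]| <= 1)%N.
Proof.
move=> l_pr og cop; rewrite leqNgt; apply/negP => f_gt1.
have l_gt1 := prime_gt1 l_pr; have /andP[kM nkM] := mds_aut_moves.
pose u := (k.-1 %/ l)%N; pose v := ((n - k).-1 %/ l)%N.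
have leu : (u * l <= k.-1)%N := leq_trunc_div _ _.
have lev : (v * l <= (n - k).-1)%N := leq_trunc_div _ _.
have [|Ru cRu oRu] := @exists_prime_orbits _ g l l_pr og u.+1.
  by rewrite mulSn addnC ltn_add2r; apply: leq_trans kM; lia.
have [|Rv cRv oRv] := @exists_prime_orbits _ g l l_pr og v.+1.
  by rewrite mulSn addnC ltn_add2r; apply: leq_trans nkM; lia.
have ltu : (k.-1 < u.+1 * l)%N by rewrite ltn_ceil ?prime_gt0.
have ltv : ((n - k).-1 < v.+1 * l)%N by rewrite ltn_ceil ?prime_gt0.
have a_le : (\dim (C :&: lker N) <= u.+1)%N.
  by apply: leq_trans cRu; apply: dim_fixed_le; rewrite oRu; lia.
have s_ge : (n <= \dim (C + limg N) + v.+1)%N.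
  apply: leq_trans (leq_add (leqnn _) cRv).
  by apply: dim_coinvariants_le; rewrite oRv; lia.
have P_le := card_porbits_le_dim_fixed.
have P_ge := card_porbits_ge l_pr og; rewrite card_ord in P_ge.
have ab := limg_ker_dim N C; have sc := dimv_sum_cap C (limg N).
have KI := limg_ker_dim N fullv; rewrite capfv dimvf dim_matrix mul1r in KI.
(* Together with the dimension formulas above: [\dim (lker N) <= \dim (C :&: lker N) + (n - \dim (C
   + limg N))]. *)
have bc : (\dim (N @: C) <= \dim (C :&: limg N))%N.
  apply/dimvS/subvP => _ /memv_imgP[x Cx ->].
  by rewrite memv_cap N_C ?memv_img ?memvf.
have {P_le} : (#|porbits g| <= u + v + 2)%N.
  move: P_le KI ab sc bc a_le s_ge.
  move: (\dim (lker N)) (\dim (limg N)) (\dim (N @: C)) (\dim (C :&: lker N)).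
  move: (\dim (C :&: limg N)) (\dim (C + limg N)).
  by move: (k) (u) (v) #|porbits g| => k0 u0 v0 p c s a b d e; lia.
rewrite -(leq_pmul2l (prime_gt0 l_pr)) => /(leq_trans P_ge).
rewrite !mulnDr ![(l * _)%N]mulnC.
move: f_gt1; move: #|_| => f f_gt1 le_nf.
have l1_gt0 : (0 < l.-1)%N by case: (l) l_gt1 => [|[]].
(* The inequality reads [n + (l - 1) * f <= u * l + v * l + 2 * l], and the right side is at most
   [n - 2 + 2 * l]. *)
have f2 : f = 2%N.
  apply/eqP; rewrite eqn_leq f_gt1 andbT -(leq_pmul2l l1_gt0).
  by rewrite [(l.-1 * f)%N]mulnC; move: le_nf; lia.
(* At [f = 2] both floors are exact, so [l] divides [k - 1] and [n - k - 1], whose sum is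
   [n - 2]. *)
have dl : (l %| gcdn (n - 2) (n - k).-1)%N.
  have ev : (n - k).-1 = (v * l)%N by move: le_nf; rewrite f2; lia.
  have eu : k.-1 = (u * l)%N by move: le_nf; rewrite f2; lia.
  rewrite dvdn_gcd ev dvdn_mull // andbT.
  by have -> : (n - 2 = (u + v) * l)%N; [rewrite mulnDl -ev -eu; lia | rewrite dvdn_mull].
by move: dl; rewrite (eqP cop) dvdn1 => /eqP l1; rewrite l1 in l_gt1.
Qed.

End NontrivialAutomorphism.
End Automorphism.
End MDSCodes.

(** * The permutation group of a code *)

Section PermutationGroup.
Variables (F : finFieldType) (n : nat) (C : {vspace 'rV[F]_n}).

Lemma mem_Per (g : 'S_n) :
  reflect (forall x, (col_perm g x \in C) = (x \in C)) (g \in Per C).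
Proof.
have gK (x : 'rV[F]_n) : col_perm g^-1 (col_perm g x) = x.
  by rewrite -col_permM mulVg col_perm1.
have gVK (x : 'rV[F]_n) : col_perm g (col_perm g^-1 x) = x.
  by rewrite -col_permM mulgV col_perm1.
rewrite inE; apply: (iffP eqP) => [gC x|gC].
  apply/idP/idP => [Cgx|].
    by rewrite -gC -[x]gK -lfunE memv_img.
  by rewrite -{1}gC => /memv_imgP[y Cy ->]; rewrite lfunE /= gVK.
apply/eqP; rewrite eqEsubv; apply/andP; split; apply/subvP => x.
  by case/memv_imgP=> y Cy ->; rewrite lfunE /= -gC gVK.
by move=> Cx; rewrite -[x]gK -lfunE memv_img // gC.
Qed.

Lemma group_set_Per : group_set (Per C).
Proof.
apply/group_setP; split=> [|g h /mem_Per gC /mem_Per hC]; apply/mem_Per => x.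
  by rewrite col_perm1.
by rewrite col_permM gC hC.
Qed.

Canonical Per_group := Group group_set_Per.

End PermutationGroup.

Lemma ntransitive2P (T : finType) (G : {group {perm T}}) (x y x' y' : T) :
  [transitive^2 G, on [set: T] | 'P]%g -> x != y -> x' != y' ->
  exists2 g, g \in G & g x = x' /\ g y = y'.
Proof.
move=> trG ne_xy ne_xy'.
have dt (a b : T) : a != b -> [tuple a; b] \in 2.-dtuple([set: T]).
  by move=> ne; rewrite inE /= inE ne subset_all /= !inE.
have [g Gg /(congr1 val) /= [-> ->]] := atransP2 trG (dt _ _ ne_xy) (dt _ _ ne_xy').
by exists g.
Qed.

(** * Sharply doubly transitive groups containing a full cycle *)

Section SharplyTransitive.
Variable m : nat.
(** This form gives ['I_n] the ring structure of Z/n. *)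
Local Notation n := m.+2.
Variable G : {group 'S_n}.
Hypotheses (shiftG : shift n \in G).
Hypothesis trG : [transitive^2 G, on [set: 'I_n] | 'P]%g.
Hypothesis sharpG : forall g i j, g \in G -> i != j -> g i = i -> g j = j -> g = 1%g.

Lemma shiftX_E j (x : 'I_n) : (shift n ^+ j)%g x = x + j%:R.
Proof.
elim: j => [|j IHj]; first by rewrite perm1 addr0.
rewrite expgSr permM IHj permE -natr1 addrA; apply: val_inj => /=.
by rewrite modnDmr addn1.
Qed.

(** Either the differences [g x - x] are distinct and so take the value 0, or a value [a] repeats
    and [g] agrees twice with translation by [a], a power of the shift. *)
Lemma fixes_or_translation g : g \in G ->
  (exists x, g x = x) \/ exists a, forall x, g x = x + a.
Proof.
move=> Gg; have [inj_d|] := boolP (injectiveb (fun x : 'I_n => g x - x)).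
  left; have /codomP[x /esym/eqP] : 0 \in codom (fun x : 'I_n => g x - x).
    by apply: injF_onto; apply/injectiveP.
  by rewrite subr_eq0 => /eqP; exists x.
case/injectivePn => x [y ne_xy e]; right; exists (g x - x).
pose a := g x - x; pose t := (shift n ^+ a)%g.
have tE w : t w = w + a by rewrite shiftX_E natr_Zp.
have Gt : (g * t^-1)%g \in G by rewrite groupM ?groupV ?groupX.
have gt w : g w - w = a -> (g * t^-1)%g w = w.
  by move=> ew; rewrite permM; apply: (canLR (permK t)); rewrite tE -ew addrC subrK.
have /eqP := sharpG Gt ne_xy (gt _ erefl) (gt _ (esym e)).
by rewrite -eq_mulgV1 => /eqP gt_eq z; rewrite {1}gt_eq tE.
Qed.

Lemma affine_action g : g \in G ->
  forall x, g x = g 0 + (g 1 - g 0) * x.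
Proof.
move=> Gg; pose h := (shift n ^ g)%g.
have hE x : h (g x) = g (x + 1).
  by rewrite /h permJ -[shift n]expg1 shiftX_E.
have Gh : h \in G by rewrite groupJ.
(* The conjugate [h] sends [g x] to [g (x + 1)], so it has no fixed point and is a translation. *)
have [[y]|[a ha]] := fixes_or_translation Gh.
  rewrite -[y](permKV g) hE => /perm_inj /eqP.
  by rewrite -subr_eq0 addrC addKr oner_eq0.
have gS x : g (x + 1) = g x + a by rewrite -hE ha.
have -> : g 1 - g 0 = a by rewrite -[1]add0r gS addrC addKr.
move=> x; rewrite -[x]natr_Zp; elim: (val x) => [|j IHj].
  by rewrite mulr0 addr0.
by rewrite -natr1 gS IHj mulrDr mulr1 addrA.
Qed.

(** The element fixing 0 and sending 1 to [b] is multiplication by [b]; its surjectivity makes [b] a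
    unit. A proper divisor [pdiv n] would be a nonzero non-unit. *)
Lemma degree_prime : prime n.
Proof.
have cop (b : 'Z_n) : b != 0 -> coprime n b.
  rewrite eq_sym => b0; have ne01 : (0 : 'I_n) != 1 by rewrite eq_sym oner_eq0.
  have [g Gg [g0 g1]] := ntransitive2P trG ne01 b0.
  have := affine_action Gg ((g^-1)%g 1); rewrite permKV g0 g1 subr0 add0r => e.
  rewrite -(unitZpE b (isT : (1 < n)%N)) natr_Zp; apply/unitrPr.
  by exists ((g^-1)%g 1).
have [lt_pn|] := ltnP (pdiv n) n; last first.
  move=> le_np; have /eqP <- : pdiv n == n by rewrite eqn_leq pdiv_leq.
  exact: pdiv_prime.
have := cop (Ordinal lt_pn).
rewrite -val_eqE /= -lt0n pdiv_gt0 coprime_sym prime_coprime ?pdiv_prime //.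
by rewrite pdiv_dvd => /(_ isT).
Qed.

Lemma perm_equiv_AGL1 : perm_equiv G (AGL1 n).
Proof.
have n_pr := degree_prime.
(* ['F_n] is built on the least prime factor of [n], so identifying it with Z/n takes a cast and the
   primality of [n]. *)
pose f (i : 'I_n) : 'F_n := (val i)%:R.
have fD x y : f (x + y) = f x + f y by rewrite /f /= Fp_nat_mod // natrD.
have fM x y : f (x * y) = f x * f y by rewrite /f /= Fp_nat_mod // natrM.
have f0 : f 0 = 0 by [].
have f1 : f 1 = 1 by rewrite /f /= modn_small.
have f_inj : injective f.
  move=> i j /(congr1 val); rewrite /f /= !val_Fp_nat // !modn_small ?ltn_ord //.
  exact: val_inj.
have f_bij : bijective f by apply: inj_card_bij; rewrite // card_Fp // card_ord.
exists f => // s t st; apply/idP/idP => [Gs|].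
  rewrite inE; apply/existsP; exists (f (s 1 - s 0)).
  apply/existsP; exists (f (s 0)); apply/andP; split.
    by rewrite -f0 (inj_eq f_inj) subr_eq0 (inj_eq perm_inj) oner_eq0.
  apply/forallP => y; have [f' _ ff'] := f_bij; rewrite -[y]ff' -st.
  by rewrite (affine_action Gs) fD fM addrC.
rewrite inE => /existsP[a /existsP[b /andP[_ /forallP tE]]].
have fs x : f (s x) = a * f x + b by rewrite st (eqP (tE _)).
have ne01 : (0 : 'I_n) != 1 by rewrite eq_sym oner_eq0.
(* Some [g] in [G] agrees with [s] at 0 and 1, and affine maps agreeing there are equal. *)
have [|g Gg [g0 g1]] := ntransitive2P trG ne01 (_ : s 0 != s 1).
  by rewrite (inj_eq perm_inj).
suff -> : s = g by [].
apply/permP => x; apply: f_inj; rewrite (affine_action Gg) fD fM g0 g1 fs.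
have bE : f (s 0) = b by rewrite fs f0 mulr0 add0r.
have -> : f (s 1 - s 0) = a.
  by apply: (addIr b); rewrite -{1}bE -fD subrK fs f1 mulr1.
by rewrite bE addrC.
Qed.

End SharplyTransitive.

(* Application to the permutation group of an MDS cyclic code *)
Local Close Scope ring_scope.

(** A suitable power [h] of [g] has prime order and still fixes both points. *)
Lemma Per_two_fixed_points (F : finFieldType) (n : nat) (C : {vspace 'rV[F]_n}) g i j :
  MDS C -> (2 < min_dist C < n)%N -> coprime (n - 2) (min_dist C - 2) ->
  g \in Per C -> i != j -> g i = i -> g j = j -> g = 1%g.
Proof.
move=> mdsC /andP[d_gt2 d_lt] cop Gg ne_ij gi gj; apply/eqP/negPn/negP => g1.
have dimC := eqP mdsC.
pose l := pdiv #[g]%g; pose h := (g ^+ (#[g] %/ l))%g.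
have l_pr : prime l by rewrite pdiv_prime // order_gt1.
have dvd : (#[g]%g %/ l %| #[g]%g)%N by apply/dvdn_div/pdiv_dvd.
have oh : #[h]%g = l.
  by rewrite orderXdiv // divnA ?pdiv_dvd // mulKn // order_gt0.
have hfix x : g x = x -> h x = x.
  by move=> gx; rewrite permX; elim: (_ %/ _)%N => //= r ->.
have h1 : h != 1%g by rewrite -order_gt1 oh prime_gt1.
have hC x : x \in C -> col_perm h x \in C.
  by have /mem_Per -> : h \in Per_group C by rewrite groupX.
have := @prime_aut_fix_le1 F n C mdsC h hC _ _ h1 l l_pr oh.
rewrite dimC; have -> : (n - (n - min_dist C + 1)).-1 = (min_dist C - 2)%N by lia.
move=> /(_ _ _ cop) le1.
have: (#|[set i; j]| <= #|[set x | h x == x]|)%N.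
  by apply/subset_leq_card/subsetP => x /set2P[] ->; rewrite inE hfix.
(* As [k = n - min_dist C + 1], the bound [min_dist C < n] gives [k > 1] and [min_dist C > 2] gives
   [k + 2 <= n]. *)
by rewrite cards2 ne_ij leqNgt ltnS le1 //; lia.
Qed.

Theorem theorem8 (p' s n : nat) (F : finFieldType) (C : {vspace 'rV[F]_n}) :
  prime p' ->
  #|F| = (p' ^ s)%N ->
  ~~ elementary C ->
  MDS C ->
  cyclic_code C ->
  5 < n ->
  2 < min_dist C < n ->
  gcdn (n - 2) (min_dist C - 2) = 1%N ->
  [transitive^2 (Per C), on [set: 'I_n] | 'P]%g ->
  (exists p : nat, [/\ prime p, n = p & perm_equiv (Per C) (AGL1 p)]) \/
  (exists d : nat, [/\ 3 <= d, n = (p' ^ d - 1) %/ (p' - 1),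
                       gcdn (p' - 1) d = 1%N & perm_equiv (Per C) (PSL d p')]).
Proof.
move=> _ _ _ mdsC cycC n_gt5 d_bnd /eqP cop trC; left; exists n.
(* The bound on [n] allows writing it as [m.+2], which turns the coordinates into Z/n. *)
case: n => [|[|m]] // in C mdsC cycC n_gt5 d_bnd cop trC *.
have sharpC g i j := @Per_two_fixed_points F _ C g i j mdsC d_bnd cop.
split=> //; first exact: (@degree_prime m (Per_group C)).
exact: (@perm_equiv_AGL1 m (Per_group C)).
Qed.
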